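(* Every single-coalition-first action model is $z$-representable by a single-coalition-first neighborhood model.
   Context: $AG$ is a finite nonempty set of agents, $AP$ a countable set of atomic propositions. For a nonempty set $AC$ and $C\subseteq AG$, $JA_C$ is the set of functions $\sigma_C:C\to AC$ ($JA_\emptyset=\{\emptyset\}$); $\sigma_C|_{\{a\}}$ is the restriction to $\{a\}$. A single-coalition-first action model is $M=(ST,AC,suc,\{out_a\}_{a\in AG},L)$ with $ST,AC$ nonempty, $suc:ST\to\mathcal P(ST)$, $out_a:ST\times JA_{\{a\}}\to\mathcal P(ST)$ with $\bigcup\{out_a(s,\sigma_a)\mid\sigma_a\in JA_{\{a\}}\}=suc(s)$ for all $s$, and $L:ST\to\mathcal P(AP)$. It determines $out_\emptyset(s,\emptyset)=suc(s)$, $out_C(s,\sigma_C)=\bigcap\{out_a(s,\sigma_C|_{\{a\}})\mid a\in C\}$ for nonempty $C$, $av_C(s)=\{\sigma_C\mid out_C(s,\sigma_C)\neq\emptyset\}$, and the actual effectivity functions $AE_C(s)=\{out_C(s,\sigma_C)\mid\sigma_C\in av_C(s)\}$. A single-coalition-first neighborhood model is $N=(ST,suc,\{nei_a\}_{a\in AG},L)$ with $suc:ST\to\mathcal P(ST)$, $L:ST\to\mathcal P(AP)$, and for all $a,s$, $nei_a(s)\subseteq\mathcal P(ST)$ a cover of $suc(s)$ (union is $suc(s)$ and $\emptyset\notin nei_a(s)$). For families of nonempty sets, $\Delta_1\odot\Delta_2=\{Y_1\cap Y_2\mid Y_1\in\Delta_1,Y_2\in\Delta_2,Y_1\cap Y_2\neq\emptyset\}$,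 extended to finitely many families ($\bigodot\{\Delta\}=\Delta$). Its neighborhood functions: $nei_C(s)=\emptyset$ if $suc(s)=\emptyset$; $\{suc(s)\}$ if $suc(s)\neq\emptyset$ and $C=\emptyset$; $\bigodot\{nei_a(s)\mid a\in C\}$ otherwise. $M$ is $z$-representable by $N$ if they have the same state set $ST$ and labeling $L$ and $AE_C=nei_C$ for every $C\subseteq AG$. *)

(* Defs.v *)
From mathcomp Require Import all_boot.
From mathcomp Require Import boolp classical_sets.

Set Implicit Arguments.
Unset Strict Implicit.
Unset Printing Implicit Defensive.

Local Open Scope classical_set_scope.

(* Coalitions are elements of [{set AG}] (finset), sets of states are
   elements of [set ST] (classical_sets); [set0] below is the classical empty
   set, and the empty coalition is written [finset.set0]. *)

Section JointActions.
Variables (AG : finType) (AC : Type).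

Definition JA (C : {set AG}) : Type := {a : AG | a \in C} -> AC.

Definition restrict (C D : {set AG}) (sDC : D \subset C) (sigma : JA C) : JA D :=
  fun x => sigma (exist _ (sval x) (fintype.subsetP sDC _ (svalP x))).

Lemma sub1_coalition (C : {set AG}) (x : {a : AG | a \in C}) :
  [set sval x]%SET \subset C.
Proof. by rewrite finset.sub1set; case: x. Qed.

Definition restrict1 (C : {set AG}) (sigma : JA C) (x : {a : AG | a \in C}) :
  JA [set sval x]%SET := restrict (sub1_coalition x) sigma.

End JointActions.

Arguments restrict {AG AC C D} sDC sigma.
Arguments restrict1 {AG AC C} sigma x.

(* The state set is a parameter of both kinds of models, so that two models
   having the same state set is expressed by their types. *)
Record action_model (AG : finType) (AP : countType) (ST : Type) := ActionModel {
  am_ST_nonempty : inhabited ST;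
  am_AC : Type;
  am_AC_nonempty : inhabited am_AC;
  am_suc : ST -> set ST;
  am_out1 : forall a : AG, ST -> JA am_AC [set a]%SET -> set ST;
  am_out1_suc : forall (a : AG) (s : ST),
    \bigcup_(sigma in [set: JA am_AC [set a]%SET]) am_out1 s sigma = am_suc s;
  am_label : ST -> set AP
}.

Arguments am_out1 {AG AP ST} M a s sigma : rename.

Definition am_out (AG : finType) (AP : countType) (ST : Type)
    (M : action_model AG AP ST) (C : {set AG}) (s : ST)
    (sigma : JA (am_AC M) C) : set ST :=
  if C == finset.set0 then am_suc M s
  else \bigcap_(x in [set: {a : AG | a \in C}])
         am_out1 M (sval x) s (restrict1 sigma x).

Arguments am_out {AG AP ST} M C s sigma.

Definition am_av (AG : finType) (AP : countType) (ST : Type)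
    (M : action_model AG AP ST) (C : {set AG}) (s : ST) : set (JA (am_AC M) C) :=
  [set sigma | am_out M C s sigma <> set0].

Arguments am_av {AG AP ST} M C s.

Definition AE (AG : finType) (AP : countType) (ST : Type)
    (M : action_model AG AP ST) (C : {set AG}) (s : ST) : set (set ST) :=
  [set am_out M C s sigma | sigma in am_av M C s].

Arguments AE {AG AP ST} M C s.

Section Odot.
Variable T : Type.
Implicit Types D : set (set T).

Definition odot D1 D2 : set (set T) :=
  [set Z | exists Y1 Y2, [/\ D1 Y1, D2 Y2, Y1 `&` Y2 <> set0 & Z = Y1 `&` Y2]].

(* The value at the empty list is a convention that is never used: the operator
   is only applied to the families indexed by a nonempty coalition. *)
Fixpoint bigodot (Ds : seq (set (set T))) : set (set T) :=
  match Ds with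
  | [::] => set0
  | [:: D] => D
  | D :: Ds' => odot D (bigodot Ds')
  end.

(* [bigodot] does not depend on the order in which the families are listed. *)
Lemma odotC D1 D2 : odot D1 D2 = odot D2 D1.
Proof.
by apply/seteqP; split=> Z [Y1 [Y2 [h1 h2 h ->]]];
  exists Y2, Y1; rewrite setIC in h *.
Qed.

Lemma odotA D1 D2 D3 : odot D1 (odot D2 D3) = odot (odot D1 D2) D3.
Proof.
apply/seteqP; split=> Z.
- move=> [Y1 [_ [h1 [Y2 [Y3 [h2 h3 _ ->]]] h ->]]].
  exists (Y1 `&` Y2), Y3; rewrite -setIA; split=> //.
  by exists Y1, Y2; split=> // h0; apply: h; rewrite setIA h0 set0I.
- move=> [_ [Y3 [[Y1 [Y2 [h1 h2 _ ->]]] h3 h ->]]].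
  exists Y1, (Y2 `&` Y3); rewrite setIA; split=> //.
  by exists Y2, Y3; split=> // h0; apply: h; rewrite -setIA h0 setI0.
Qed.

End Odot.

Record nbhd_model (AG : finType) (AP : countType) (ST : Type) := NbhdModel {
  nm_ST_nonempty : inhabited ST;
  nm_suc : ST -> set ST;
  nm_nei1 : AG -> ST -> set (set ST);
  nm_nei1_suc : forall (a : AG) (s : ST),
    \bigcup_(Y in nm_nei1 a s) Y = nm_suc s;
  nm_nei1_nonempty : forall (a : AG) (s : ST), ~ nm_nei1 a s set0;
  nm_label : ST -> set AP
}.

(* The families [nm_nei1 a s] are listed agent by agent: two agents with equal
   families contribute two factors, not one. *)
Definition nei (AG : finType) (AP : countType) (ST : Type)
    (N : nbhd_model AG AP ST) (C : {set AG}) (s : ST) : set (set ST) :=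
  if `[< nm_suc N s = set0 >] then set0
  else if C == finset.set0 then [set nm_suc N s]
  else bigodot [seq nm_nei1 N a s | a <- enum C].

Arguments nei {AG AP ST} N C s.

Definition z_representable (AG : finType) (AP : countType) (ST : Type)
    (M : action_model AG AP ST) (N : nbhd_model AG AP ST) : Prop :=
  am_label M = nm_label N /\ forall C : {set AG}, AE M C = nei N C.

(* Main.v *)
(** Take [nei_a(s)] to be the family of nonempty sets [out_a(s, sigma_a)].  A
    joint action of a nonempty coalition [C] is an independent choice of one
    individual action per member of [C], so the nonempty sets
    [out_C(s, sigma_C)] are exactly the nonempty intersections of one member of
    [nei_a(s)] for each [a] in [C]. *)

Require Import Defs.
From mathcomp Require Import all_boot.
From mathcomp Require Import boolp classical_sets.

Local Open Scope classical_set_scope.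

(* [uniq l] is needed: a repeated index contributes two independent factors. *)
Lemma bigodotP (I : eqType) (T : Type) (D : I -> set (set T)) (l : seq I)
    (Z : set T) :
  (forall i, ~ D i set0) -> uniq l -> l <> [::] ->
  bigodot [seq D i | i <- l] Z <->
  Z <> set0 /\ exists f : I -> set T,
    (forall i, i \in l -> D i (f i)) /\ Z = \bigcap_(i in [set` l]) f i.
Proof.
move=> D0; elim: l Z => [//|i [|j l] IH] Z.
- move=> _ _; split=> [DZ | [_ [f [Df ->]]]].
    (* On a one-element list [bigodot] filters nothing, so nonemptiness of [Z] comes from the
       hypothesis on [D]. *)
    split; first by move=> Z0; apply: (D0 i); rewrite -Z0.
    exists (fun=> Z); split; first by move=> k /[!inE] /eqP ->.
    apply/seteqP; split=> [z Zz // | z]; apply; exact: mem_head.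
  suff -> : \bigcap_(k in [set` [:: i]]) f k = f i by apply: Df; exact: mem_head.
  apply/seteqP; split=> [z | z fz k /=]; first by apply; exact: mem_head.
  by rewrite inE => /eqP ->.
- rewrite cons_uniq => /andP[il ul] _.
  have bigcapE (f : I -> set T) :
      \bigcap_(k in [set` i :: j :: l]) f k =
      f i `&` \bigcap_(k in [set` j :: l]) f k.
    apply/seteqP; split=> [z fz | z [fi fz] k /=].
      split=> [|k kl]; first by apply: fz; exact: mem_head.
      by apply: fz; rewrite /= in_cons; apply/orP; right.
    by rewrite in_cons => /orP[/eqP -> // | ]; exact: fz.
  split=> [[Y1 [Y2 [DY1 /IH [] // Y20 [f [Df Y2E]] Y0 ->]]] | [Z0 [f [Df ZE]]]].
    (* Changing [f] at [i] leaves the intersection over the tail intact, since [i] does not occur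
       there. *)
    split=> //; exists (fun k => if k == i then Y1 else f k); split.
      move=> k; rewrite in_cons; case: eqVneq => [-> // | _]; exact: Df.
    rewrite bigcapE eqxx Y2E; congr (_ `&` _); apply: eq_bigcapr => k /= kl.
    by case: eqVneq => // ki; rewrite -ki kl in il.
  rewrite bigcapE in ZE; rewrite ZE in Z0 *.
  exists (f i), (\bigcap_(k in [set` j :: l]) f k); split=> //.
    by apply: Df; exact: mem_head.
  (* The intersection over the tail contains the nonempty full one. *)
  apply/IH => //; split; first by move=> E0; apply: Z0; rewrite E0 setI0.
  by exists f; split=> // k kl; apply: Df; rewrite in_cons kl orbT.
Qed.

Section IndividualNeighborhoods.
Variables (AG : finType) (AP : countType) (ST : Type) (M : action_model AG AP ST).
Implicit Types (a : AG) (C : {set AG}) (s : ST).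

(** Individual actions are taken as elements of [am_AC M], which avoids functions on a singleton
    subtype; [JA1_const] shows that none is lost. *)
Definition action_out a s (c : am_AC M) : set ST := am_out1 M a s (fun=> c).

Lemma JA1_const a (sigma : JA (am_AC M) [set a]%SET) :
  exists c, sigma = fun=> c.
Proof.
exists (sigma (exist _ a (set11 a))); apply: funext => x; congr sigma.
by apply: val_inj => /=; exact/finset.set1P/(svalP x).
Qed.

Lemma bigcup_action_out a s :
  \bigcup_(c in [set: am_AC M]) action_out a s c = am_suc M s.
Proof.
rewrite -(am_out1_suc M a s); apply/seteqP; split=> t [x _ xt].
  by exists (fun=> x).
by have [c cE] := JA1_const a x; exists c => //; rewrite /action_out -cE.
Qed.

Lemma am_outE C s (sigma : JA (am_AC M) C) : C <> finset.set0 ->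
  am_out M C s sigma =
  \bigcap_(x in [set: {a : AG | a \in C}]) action_out (sval x) s (sigma x).
Proof.
move=> /eqP/negbTE C0; rewrite /am_out C0; apply: eq_bigcapr => x _.
rewrite /action_out; congr am_out1; apply: funext => y.
rewrite /restrict1 /restrict; congr sigma; apply: val_inj => /=.
exact/finset.set1P/(svalP y).
Qed.

(** Any member of [C] already confines the intersection to its own outcome set. This settles the
    case of no successors. *)
Lemma am_out_suc C s (sigma : JA (am_AC M) C) :
  am_out M C s sigma `<=` am_suc M s.
Proof.
have [C0 | [a aC]] := set_0Vmem C; first by move/eqP: C0 => C0; rewrite /am_out C0.
rewrite am_outE; last by move=> C0; rewrite C0 inE in aC.
move=> t /(_ (exist _ a aC) I) ta; rewrite -(bigcup_action_out a).
by exists (sigma (exist _ a aC)).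
Qed.

(** This is the actual effectivity function of the coalition of [a] alone, written with single
    actions. *)
Definition action_nei a s : set (set ST) :=
  [set Y | Y <> set0 /\ exists c, Y = action_out a s c].

Lemma bigcup_action_nei a s : \bigcup_(Y in action_nei a s) Y = am_suc M s.
Proof.
rewrite -(bigcup_action_out a); apply/seteqP; split=> t.
  by move=> [_ [_ [c ->]] ct]; exists c.
move=> [c _ ct]; exists (action_out a s c) => //; split; last by exists c.
by move=> c0; rewrite c0 in ct.
Qed.

Lemma action_nei_nonempty a s : ~ action_nei a s set0.
Proof. by case. Qed.

Definition nbhd_of_action_model : nbhd_model AG AP ST :=
  NbhdModel (am_ST_nonempty M) bigcup_action_nei action_nei_nonempty
    (am_label M).

Lemma AE_bigodot C s : C <> finset.set0 ->
  AE M C s = bigodot [seq action_nei a s | a <- enum C].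
Proof.
move=> C0; have eC0 : enum C <> [::].
  move=> e0; apply: C0; apply/setP => a.
  by rewrite -mem_enum e0 !inE.
apply/seteqP; split=> Z.
- move=> [sigma out0 <-].
  apply/bigodotP; [by move=> a; exact: action_nei_nonempty | exact: enum_uniq
    | exact: eC0 | split; first exact: out0].
  rewrite /am_av /= am_outE // in out0 *.
  have [c0] := am_AC_nonempty M.
  (* [bigodotP] wants a choice for every agent, while [sigma] is defined on [C] only; [c0] fills in
     the agents outside. *)
  pose c a := if boolP (a \in C) is AltTrue aC then sigma (exist _ a aC) else c0.
  have cE x : c (sval x) = sigma x.
    case: x => a aC /=; rewrite /c; case: {-}_ / boolP => [aC' | /negP//].
    by congr sigma; apply: val_inj.
  exists (fun a => action_out a s (c a)); split.
    move=> a; rewrite mem_enum => aC; split; last by exists (c a).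
    (* The outcome of each member contains the nonempty outcome of [C]. *)
    move=> a0; apply: out0; rewrite -subset0 -a0 => t.
    by move=> /(_ (exist _ a aC) I); rewrite -cE.
  apply/seteqP; split=> [t ot a /= | t ot x _].
    by rewrite mem_enum => aC; have := ot (exist _ a aC) I; rewrite -cE.
  by rewrite -cE; apply: ot; rewrite /= mem_enum; exact: (svalP x).
- move/bigodotP => [||//|Z0 [f [Df ZE]]];
    [by move=> a; exact: action_nei_nonempty | exact: enum_uniq |].
  (* One action realizing [f] is chosen per member; independent choices always assemble into a joint
     action of [C]. *)
  have /choice[c cE] : forall x : {a | a \in C}, exists c,
      f (sval x) = action_out (sval x) s c.
    by move=> [a aC]; have [|_] := Df a; first by rewrite mem_enum.
  have outE : am_out M C s c = Z.
    rewrite am_outE // ZE; apply/seteqP; split=> [t ot a /= | t ot x _].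
      by rewrite mem_enum => aC; have := ot (exist _ a aC) I; rewrite -cE.
    by rewrite -cE; apply: ot; rewrite /= mem_enum; exact: (svalP x).
  by exists c => //; rewrite /am_av /= outE.
Qed.

Lemma AE_nei C s : AE M C s = nei nbhd_of_action_model C s.
Proof.
rewrite /nei; case: asboolP => /= [suc0 | suc0].
  rewrite -subset0 => Z [sigma out0 _]; apply: out0.
  by rewrite -subset0 -suc0; exact: am_out_suc.
case: eqP => [-> | /AE_bigodot //].
apply/seteqP; split=> Z.
  by move=> [sigma _ <-]; rewrite /am_out eqxx.
(* The outcome of the empty coalition ignores the joint action, so a constant one serves as
   witness. *)
move=> ->; have [c0] := am_AC_nonempty M.
by exists (fun=> c0); rewrite /am_av /am_out /= eqxx.
Qed.

End IndividualNeighborhoods.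

Theorem theorem4p11 (AG : finType) (AG_nonempty : (0 < #|AG|)%N) (AP : countType)
    (ST : Type) (M : action_model AG AP ST) :
  exists N : nbhd_model AG AP ST, z_representable M N.
Proof.
exists (nbhd_of_action_model _ _ _ M); split=> // C.
by apply: funext => s; exact: AE_nei.
Qed.
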